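(* Let $d\ge 1$ be an integer and let $g\in L^1(\mathbb{R}^d)$ be a radial decreasing function. Then for every $\alpha>0$, $$\lambda^d\left(\{x\in\mathbb{R}^d : M_d g(x)>\alpha\}\right)\le \frac{\|g\|_1}{\alpha}.$$
   Context: $\lambda^d$ is Lebesgue measure on $\mathbb{R}^d$, $\|x\|_2$ is the euclidean norm, and $B(x,r)$ is the closed euclidean ball with center $x$ and radius $r>0$. The centered Hardy-Littlewood maximal function of a locally integrable function $g$ is $$M_d g(x):=\sup_{r>0}\frac{1}{\lambda^d(B(x,r))}\int_{B(x,r)}|g|\,d\lambda^d .$$ A function $g$ on $\mathbb{R}^d$ is radial decreasing if there is a decreasing function $f:(0,\infty)\to[0,\infty)$ with $g(x)=f(\|x\|_2)$ for all $x\neq 0$ (the value at the origin is immaterial). ''Decreasing'' means non-strictly decreasing (i.e. non-increasing). *)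

(* Defs.v *)
From HB Require Import structures.
From mathcomp Require Import all_boot all_order all_algebra.
From mathcomp Require Import all_classical all_reals all_analysis.

Set Implicit Arguments.
Unset Strict Implicit.
Unset Printing Implicit Defensive.

Import Order.TTheory GRing.Theory Num.Theory.
Import numFieldNormedType.Exports.

Local Open Scope classical_set_scope.
Local Open Scope ring_scope.
Local Open Scope ereal_scope.

(* R^n is n.-tuple (measurableTypeR R), whose sigma-algebra in the library is
   the product of the Borel sigma-algebras, i.e. the Borel sets of R^n. *)
Notation Rn R n := (n.-tuple (measurableTypeR R)).

Section cons_measure.
Context (R : realType) (n : nat).
Variable mu : {sigma_finite_measure set (Rn R n) -> \bar R}.

Definition tuple_cons (p : measurableTypeR R * Rn R n) : Rn R n.+1 :=
  [tuple of p.1 :: p.2].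

Lemma tuple_consK p : [tuple of behead (tuple_cons p)] = p.2.
Proof. exact/val_inj. Qed.

Lemma measurable_tuple_cons : measurable_fun setT tuple_cons.
Proof. exact: measurable_cons. Qed.

Definition cons_measure : set (Rn R n.+1) -> \bar R :=
  pushforward (@lebesgue_measure R \x mu) tuple_cons.

Let mpreim A : measurable A -> measurable (tuple_cons @^-1` A).
Proof.
by move=> mA; rewrite -[X in measurable X]setTI; exact: measurable_tuple_cons.
Qed.

Let cons_measure0 : cons_measure set0 = 0.
Proof. by rewrite /cons_measure /pushforward preimage_set0 measure0. Qed.

Let cons_measure_ge0 A : 0 <= cons_measure A.
Proof. by rewrite /cons_measure /pushforward measure_ge0. Qed.

Let cons_measure_sigma_additive : semi_sigma_additive cons_measure.
Proof.
move=> F mF tF mUF; rewrite /cons_measure /pushforward preimage_bigcup.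
apply: measure_semi_sigma_additive.
- by move=> n0; exact: mpreim.
- apply/trivIsetP => i j _ _ ij; rewrite -preimage_setI.
  by move/trivIsetP : tF => /(_ _ _ _ _ ij) ->//; rewrite preimage_set0.
- by rewrite -preimage_bigcup; exact: mpreim.
Qed.

HB.instance Definition _ := isMeasure.Build _ _ _ cons_measure
  cons_measure0 cons_measure_ge0 cons_measure_sigma_additive.

Lemma cons_measureE (A : set (measurableTypeR R)) (B : set (Rn R n)) :
  measurable A -> measurable B ->
  cons_measure [set x | A (thead x) /\ B [tuple of behead x]] =
  lebesgue_measure A * mu B.
Proof.
move=> mA mB; rewrite -product_measure1E//.
rewrite /cons_measure /pushforward; congr (product_measure1 _ _ _).
by apply/funext => p; rewrite /preimage/= theadE tuple_consK.
Qed.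

Lemma sigma_finite_cons_measure : sigma_finite setT cons_measure.
Proof.
have /sigma_finiteP[F [TF ndF Foo]] := sigma_finiteT (@lebesgue_measure R).
have /sigma_finiteP[G [TG ndG Goo]] := sigma_finiteT mu.
exists (fun k => [set x | F k (thead x) /\ G k [tuple of behead x]]).
  apply/seteqP; split => // x _.
  have [i _ Fi] : (\bigcup_i F i) (thead x) by rewrite -TF.
  have [j _ Gj] : (\bigcup_j G j) [tuple of behead x] by rewrite -TG.
  exists (maxn i j) => //; split.
    by move: Fi; exact/subsetPset/ndF/leq_maxl.
  by move: Gj; exact/subsetPset/ndG/leq_maxr.
move=> k; have [mF Fk] := Foo k; have [mG Gk] := Goo k; split.
  apply: measurableI; rewrite -[X in measurable X]setTI.
    exact: (measurable_tnth ord0).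
  exact: (@measurable_behead _ (measurableTypeR R) n measurableT _ mG).
by rewrite cons_measureE// lte_mul_pinfty// ge0_fin_numE.
Qed.

HB.instance Definition _ :=
  Measure_isSigmaFinite.Build _ _ _ cons_measure sigma_finite_cons_measure.

End cons_measure.

(* Lebesgue measure on R^n: the n-fold product of lebesgue_measure. *)
Fixpoint lebesgue_Rn (R : realType) (n : nat) :
    {sigma_finite_measure set (Rn R n) -> \bar R} :=
  match n with
  | 0 => \d_([tuple] : Rn R 0)
  | m.+1 => cons_measure (lebesgue_Rn R m)
  end.

Lemma lebesgue_Rn_box (R : realType) (n : nat)
    (A : 'I_n -> set (measurableTypeR R)) :
  (forall i, measurable (A i)) ->
  lebesgue_Rn R n [set x | forall i, A i (tnth x i)] =
  \prod_(i < n) lebesgue_measure (A i).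
Proof.
elim: n A => [|n IHn] A mA.
  by rewrite big_ord0 /= diracE mem_set//= => -[].
rewrite big_ord_recl -IHn//= -cons_measureE//; last first.
  rewrite [X in measurable X](_ : _ = \bigcap_(i in [set: 'I_n])
      ((fun x : Rn R n => tnth x i) @^-1` A (lift ord0 i))).
    apply: fin_bigcap_measurable => // i _.
    by rewrite -[X in measurable X]setTI; exact: measurable_tnth.
  by apply/seteqP; split=> x /= Ax i => [_|]; exact: Ax.
congr (cons_measure _ _); apply/seteqP; split=> x /=.
  move=> Ax; split=> [|i]; first exact: Ax.
  have := Ax (lift ord0 i); rewrite {1}(tuple_eta x) tnthS.
  by congr (A _ (tnth _ _)); exact/val_inj.
move=> [A0 Ax] i; case: (unliftP ord0 i) => [j|] -> //.
rewrite (tuple_eta x) tnthS; have := Ax j.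
by congr (A _ (tnth _ _)); exact/val_inj.
Qed.

Section euclidean.
Context (R : realType) (n : nat).
Implicit Types (x y : Rn R n) (r : R) (g : Rn R n -> R).

Definition enorm x : R := Num.sqrt (\sum_(i < n) tnth x i ^+ 2)%R.

Definition esub y x : Rn R n := [tuple (tnth y i - tnth x i)%R | i < n].

Definition ecball x r : set (Rn R n) := [set y | (enorm (esub y x) <= r)%R].

(* Values in \bar R: the supremum, or the integrals themselves, may be +oo. *)
Definition centered_maximal g x : \bar R :=
  ereal_sup [set (\int[lebesgue_Rn R n]_(y in ecball x r) `|(g y)%:E|) /
                 lebesgue_Rn R n (ecball x r) | r in [set r : R | (0 < r)%R]].

(* Only the restriction of f to ]0, +oo[ matters; g is unconstrained at 0. *)
Definition radial_decreasing g : Prop :=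
  exists f : R -> R,
    [/\ forall s, (0 < s)%R -> (0 <= f s)%R,
        forall s t, (0 < s)%R -> (s <= t)%R -> (f t <= f s)%R &
        forall x, x <> [tuple 0%R | i < n] -> g x = f (enorm x)].

End euclidean.

(* Main.v *)
(* For [t <= s = |x|] the balls B(x, r) and B(0, t) meet in a set contained
   in a ball of radius r t / s, so that B(x, r) is filled by B(0, t) in at most
   the same proportion (t / s)^d as B(0, s). Applied to the superlevel sets of
   [|g|], which are balls about the origin up to the origin itself, and
   integrated over the levels, this bounds every mean of [|g|] over a ball
   centred at x by its mean over B(0, |x|). Hence M g(x) > alpha forces
   |x|^d vol(B(0, 1)) <= |g|_1 / alpha, that is, x lies in a ball about the
   origin of volume |g|_1 / alpha. *)
Require Import Defs.
From mathcomp Require Import all_boot all_order all_algebra.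
From mathcomp Require Import all_classical all_reals all_analysis.
From mathcomp Require Import measurable_realfun ring lra.

Import Order.TTheory GRing.Theory Num.Theory.
Local Open Scope classical_set_scope.
Local Open Scope ring_scope.
Local Open Scope ereal_scope.

(** * Monotonicity for arbitrary sets and integrands *)

(* The integral is a supremum over simple functions below the integrand, so it
   is monotone even for nonmeasurable integrands. *)
Lemma ge0_le_integral_nomeas {dT : measure_display} {T : measurableType dT}
    {R : realType} (mu : {measure set T -> \bar R}) (f1 f2 : T -> \bar R) :
  (forall x, 0 <= f1 x) -> (forall x, f1 x <= f2 x) ->
  \int[mu]_x f1 x <= \int[mu]_x f2 x.
Proof.
move=> f10 f12; rewrite !ge0_integralTE// => [|x]; last exact: le_trans (f12 x).
apply: ereal_sup_le => _ /= [h hf1 <-]; exists h => // x.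
exact: le_trans (f12 x).
Qed.

(* [lebesgue_Rn] is monotone on all sets, which spares proving that the
   superlevel sets of the maximal function are measurable. *)
Lemma le_lebesgue_Rn {R : realType} {n : nat} (A B : set (Rn R n)) :
  A `<=` B -> lebesgue_Rn R n A <= lebesgue_Rn R n B.
Proof.
elim: n A B => [|n IHn] A B AB /=.
  rewrite !diracE lee_fin ler_nat.
  by case: (boolP (_ \in A)) => // /set_mem/AB/mem_set ->.
apply: ge0_le_integral_nomeas => [x|x] /=; first exact: measure_ge0.
apply: IHn => y; rewrite /xsection/= !inE; exact: AB.
Qed.

(** * Affine changes of variables *)

(** Uniqueness of Lebesgue measure reduces the claim to half-open intervals. *)
Lemma lebesgue_measure_affine {R : realType} (z c : R)
    (A : set (measurableTypeR R))
    (T := (fun u => (u - z) / c)%R : measurableTypeR R -> measurableTypeR R) :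
  (0 < c)%R -> measurable A ->
  lebesgue_measure (T @^-1` A) = c%:E * lebesgue_measure A.
Proof.
move=> c0 mA.
have mT : measurable_fun setT T.
  by apply: measurable_funM => //; apply: measurable_funB.
have ci0 : (0 <= c^-1)%R by rewrite invr_ge0 ltW.
suff -> : lebesgue_measure A =
    pushforward (mscale (NngNum ci0) lebesgue_measure) T A.
  by rewrite /pushforward/mscale/= muleA -EFinM divff ?gt_eqF// mul1e.
apply: lebesgue_measure_unique => // _ [[a b]] _ <- /=.
rewrite /mscale/= /pushforward.
rewrite (_ : T @^-1` _ = `]a * c + z, b * c + z]%classic)%R; last first.
  apply/seteqP; split => u /=; rewrite !in_itv/= ltr_pdivlMr// ler_pdivrMr//;
  by rewrite ltrBrDr lerBlDr.
rewrite !lebesgue_measure_itv/= !lte_fin ltrD2r ltr_pM2r//.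
case: ifPn => [_|_]; last by rewrite mule0.
by rewrite -!EFinB -EFinM; congr EFin; field; rewrite gt_eqF.
Qed.

(** Induction by slicing along the first coordinate: each slice contributes [c ^+ n], and the
    one-dimensional change of variable the last factor [c]. *)
Lemma lebesgue_Rn_affine {R : realType} {n : nat} (z : Rn R n) (c : R)
    (A : set (Rn R n)) : (0 < c)%R -> measurable A ->
  lebesgue_Rn R n [set x | A [tuple ((tnth x i - tnth z i) / c)%R | i < n]] =
  (c ^+ n)%:E * lebesgue_Rn R n A.
Proof.
move=> c0; elim: n z A => [|n IHn] z A mA /=.
  rewrite expr0 mul1e; congr (\d_ _ _); apply/seteqP.
  by split=> x /=; rewrite (tuple0 (mktuple _)) (tuple0 x).
pose B := @tuple_cons R n @^-1` A.
have mB : measurable B.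
  by rewrite -[X in measurable X]setTI; exact: measurable_tuple_cons.
pose T : measurableTypeR R -> measurableTypeR R :=
  fun u => ((u - thead z) / c)%R.
have mT : measurable_fun [set: measurableTypeR R] T.
  by apply: measurable_funM => //; apply: measurable_funB.
pose phi (u : measurableTypeR R) := lebesgue_Rn R n (xsection B u).
have mphi : measurable_fun setT phi by exact: measurable_fun_xsection.
have phi0 u : 0 <= phi u by exact: measure_ge0.
have -> : cons_measure (lebesgue_Rn R n) A =
  \int[lebesgue_measure]_u phi u by [].
transitivity (\int[lebesgue_measure]_u ((c ^+ n)%:E * phi (T u))).
  rewrite /cons_measure /pushforward /product_measure1.
  apply: eq_integral => u _ /=.
  have mBu : measurable (xsection B (T u)) by exact: measurable_xsection.
  rewrite /phi -(IHn [tuple of behead z])//.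
  congr (lebesgue_Rn R n _); apply/seteqP.
  have E (y : Rn R n) :
      [tuple ((tnth (tuple_cons (u, y)) i - tnth z i) / c)%R | i < n.+1] =
      tuple_cons
        (T u, [tuple ((tnth y i - tnth [tuple of behead z] i) / c)%R | i < n]).
    apply: eq_from_tnth => i; rewrite tnth_mktuple.
    case: (unliftP ord0 i) => [j|] -> //=.
    have -> : tnth z (lift ord0 j) = tnth [tuple of behead z] j.
      by rewrite {1}(tuple_eta z) tnthS.
    by rewrite /tuple_cons !tnthS tnth_mktuple.
  by split=> y; rewrite /xsection/= !inE /B /= E.
have cn0 : (0 <= c ^+ n)%R by rewrite exprn_ge0// ltW.
rewrite ge0_integralZl//=; last first.
  by apply: measurableT_comp mphi mT.
rewrite exprSr EFinM -muleA; congr (_ * _).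
have ci0 : (0 <= c^-1)%R by rewrite invr_ge0 ltW.
(* The factor [c^-1] turns the pushforward of Lebesgue measure under [T] back into Lebesgue
   measure. *)
transitivity (c%:E * (c^-1%:E * \int[lebesgue_measure]_u phi (T u))).
  by rewrite muleA -EFinM divff ?gt_eqF// mul1e.
congr (_ * _).
rewrite -(ge0_integral_mscale lebesgue_measure measurableT (NngNum ci0))//=;
  last exact: measurableT_comp.
rewrite -(ge0_integral_pushforward mT _ measurableT mphi)//.
apply: eq_measure_integral => D mD _.
rewrite /pushforward /mscale/=.
transitivity (c^-1%:E * (c%:E * lebesgue_measure D)).
  by congr (_ * _); rewrite -(lebesgue_measure_affine (thead z)).
by rewrite muleA -EFinM mulVf ?gt_eqF// mul1e.
Qed.

(** * Comparison of integrals through superlevel sets *)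

(** Layer-cake formula: both integrals are integrals over the levels [u] of the measures being
    compared. *)
Lemma le_integral_superlevel {dT : measure_display} {T : measurableType dT}
    {R : realType} (mu : {sigma_finite_measure set T -> \bar R})
    (D1 D2 : set T) (h : T -> R) (c : R) :
  measurable D1 -> measurable D2 ->
  measurable_fun setT h -> (forall x, 0 <= h x)%R -> (0 <= c)%R ->
  (forall u : R, (0 <= u)%R -> mu (D1 `&` [set x | (u < h x)%R]) <=
     c%:E * mu (D2 `&` [set x | (u < h x)%R])) ->
  \int[mu]_(x in D1) (h x)%:E <= c%:E * \int[mu]_(x in D2) (h x)%:E.
Proof.
move=> mD1 mD2 mh h0 c0 le12.
(* The region under the graph of [h] over [D]; its slice at height [u >= 0] is a strict superlevel
   set. *)
pose A D := [set p : T * measurableTypeR R | D p.1 /\ (0 <= p.2 < h p.1)%R].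
have mA D : measurable D -> measurable (A D).
  move=> mD.
  have -> : A D = (D `*` setT) `&`
      ((fun p : T * measurableTypeR R => 0 <= p.2)%R @^-1` [set true] `&`
       (fun p : T * measurableTypeR R => p.2 < h p.1)%R @^-1` [set true]).
    apply/seteqP; split=> p /=; first by move=> [Dp /andP[? ?]].
    by move=> [[Dp _] [? ?]]; split=> //; apply/andP.
  apply: measurableI; first exact: measurableX.
  apply: measurableI; rewrite -[X in measurable X]setTI.
    have m0 : measurable_fun setT
        (fun p : T * measurableTypeR R => 0 <= p.2)%R.
      exact: measurable_fun_ler.
    exact: m0.
  have mlt : measurable_fun setT
      (fun p : T * measurableTypeR R => p.2 < h p.1)%R.
    by apply: measurable_fun_ltr => //; exact: measurableT_comp.
  exact: mlt.
have ysA D u : ysection (A D) u =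
    if (0 <= u)%R then D `&` [set x | (u < h x)%R] else set0.
  apply/seteqP; split => x; rewrite /ysection/= inE /A/=.
    by move=> [Dx /andP[-> ux]].
  by case: ifPn => // u0 [Dx ux].
(* Tonelli for the indicator of [A D], whose slice above a point [x] of [D] has length [h x]. *)
have layer D : measurable D -> \int[mu]_(x in D) (h x)%:E =
    \int[lebesgue_measure]_u mu (ysection (A D) u).
  move=> mD.
  have := indic_fubini_tonelli mu (@lebesgue_measure R) (mA _ mD).
  rewrite indic_fubini_tonelli_FE; last exact: mA.
  rewrite indic_fubini_tonelli_GE; last exact: mA.
  move=> <-; rewrite integral_mkcond; apply: eq_integral => x _ /=.
  rewrite patchE; case: ifPn => Dx.
    rewrite (_ : xsection _ _ = `[0%R, h x[%classic).
      rewrite lebesgue_measure_itv/= lte_fin sube0; case: ifPn => //.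
      by rewrite -leNgt => hx0; congr EFin; apply/le_anti; rewrite hx0 h0.
    apply/seteqP; split=> u; rewrite /xsection/= inE /A/= in_itv/=.
      by case.
    by move=> ?; split=> //; exact: set_mem.
  rewrite (_ : xsection _ _ = set0) ?measure0//.
  apply/seteqP; split => u //; rewrite /xsection/= inE /A/= => -[/mem_set].
  by rewrite (negbTE Dx).
rewrite !layer// -ge0_integralZl//; last first.
  exact: measurable_fun_ysection (mA _ mD2).
apply: ge0_le_integral_nomeas => // u; rewrite !ysA.
by case: ifPn => [/le12//|_]; rewrite !measure0 mule0.
Qed.

(** * Intersections of Euclidean balls *)

Section euclidean_geometry.
Context {R : realType} {n : nat}.
Implicit Types (x y z : Rn R n) (c r s t : R).
Local Open Scope ring_scope.

Definition escale c x : Rn R n := [tuple c * tnth x i | i < n].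

Lemma sqr_enorm x : enorm x ^+ 2 = \sum_(i < n) tnth x i ^+ 2.
Proof. by rewrite sqr_sqrtr// sumr_ge0// => i _; rewrite sqr_ge0. Qed.

Lemma enorm_ge0 x : 0 <= enorm x. Proof. exact: sqrtr_ge0. Qed.

Lemma enorm_eq0 x : enorm x = 0 -> x = [tuple 0 | i < n].
Proof.
move=> x0; apply: eq_from_tnth => i; rewrite tnth_mktuple.
have /eqP := sqr_enorm x; rewrite x0 expr0n/= eq_sym psumr_eq0; last first.
  by move=> j _; exact: sqr_ge0.
by move=> /allP/(_ i); rewrite mem_index_enum sqrf_eq0 => /(_ isT)/eqP.
Qed.

Lemma enorm0 : enorm [tuple 0 | i < n] = 0 :> R.
Proof.
by rewrite /enorm big1 ?sqrtr0// => i _; rewrite tnth_mktuple expr0n.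
Qed.

Lemma enorm_scale c x : 0 <= c -> enorm (escale c x) = c * enorm x.
Proof.
move=> c0; apply/eqP; rewrite -(@eqrXn2 _ 2)// ?mulr_ge0 ?enorm_ge0//.
rewrite exprMn !sqr_enorm mulr_sumr; apply/eqP/eq_bigr => i _.
by rewrite tnth_mktuple exprMn.
Qed.

(* Stewart's theorem for the point [a x] of the segment from the origin to x *)
Lemma sqr_enorm_sub_scale a x y :
  enorm (esub y (escale a x)) ^+ 2 =
  (1 - a) * enorm y ^+ 2 + a * enorm (esub y x) ^+ 2
    - a * (1 - a) * enorm x ^+ 2.
Proof.
rewrite !sqr_enorm !mulr_sumr -big_split/= -sumrB; apply: eq_bigr => i _.
rewrite !tnth_mktuple; ring.
Qed.

(* Two balls of radii [r] and [t] at distance [s] meet in a set contained in a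
   ball of radius [r t / s]: if [h] is the height on the side [s] of a triangle
   of sides [r], [s], [t], then [s h], twice its area, is at most [r t]. *)
Lemma ball_intersection_center x r t : 0 < r -> r < enorm x ->
  0 <= t -> t <= enorm x ->
  exists z, forall y, enorm (esub y x) <= r ->
    (enorm y <= t -> enorm x * enorm (esub y z) <= r * t) /\
    (enorm y < t -> enorm x * enorm (esub y z) < r * t).
Proof.
set s := enorm x => r0 rs t0 ts; have s0 : 0 < s by exact: lt_trans rs.
(* By the law of cosines, [a x] is the foot of the altitude on the side from the origin to [x] when
   [|y| = t] and [|y - x| = r]. *)
pose a := (s ^+ 2 + t ^+ 2 - r ^+ 2) / (2 * s ^+ 2).
have sa : 2 * (s ^+ 2 * a) = s ^+ 2 + t ^+ 2 - r ^+ 2.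
  by rewrite /a; field; rewrite gt_eqF.
(* The weights in Stewart's identity have the right sign: the first by [r < s], the second by
   [t <= s] and [0 < r]. *)
have a0 : 0 <= s ^+ 2 * a by nra.
have a1 : 0 < s ^+ 2 * (1 - a) by rewrite mulrBr mulr1; nra.
exists (escale a x) => y yx.
have e0 := enorm_ge0 (esub y (escale a x)).
have y0 := enorm_ge0 y; have yx0 := enorm_ge0 (esub y x).
have sP : (s * enorm (esub y (escale a x))) ^+ 2 =
    s ^+ 2 * (1 - a) * enorm y ^+ 2 + s ^+ 2 * a * enorm (esub y x) ^+ 2
    - s ^+ 2 * a * (s ^+ 2 - s ^+ 2 * a).
  by rewrite exprMn sqr_enorm_sub_scale -/s; ring.
have D : (s * enorm (esub y (escale a x))) ^+ 2 +
    s ^+ 2 * (1 - a) * (t ^+ 2 - enorm y ^+ 2) <= (r * t) ^+ 2.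
  rewrite sP.
  (* Heron's formula: in the extreme case [(r t)^2 - (s h)^2] is a quarter of this square. *)
  have := sqr_ge0 (t ^+ 2 + r ^+ 2 - s ^+ 2).
  have : s ^+ 2 * a * enorm (esub y x) ^+ 2 <= s ^+ 2 * a * r ^+ 2.
    by rewrite ler_wpM2l// lerXn2r// nnegrE// ltW.
  rewrite mulrBr mulr1.
  move: sa; set q := s ^+ 2 * a => sa.
  have -> : q = (s ^+ 2 + t ^+ 2 - r ^+ 2) / 2 by lra.
  rewrite !expr2; nra.
have h0 : 0 <= s * enorm (esub y (escale a x)) by rewrite mulr_ge0// ltW.
split=> yt.
  rewrite -(@ler_pXn2r _ 2)// ?nnegrE ?mulr_ge0// ?(ltW r0)//.
  apply: le_trans D; rewrite lerDl mulr_ge0 ?(ltW a1)// subr_ge0.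
  by rewrite lerXn2r// nnegrE.
rewrite -(@ltr_pXn2r _ 2)// ?nnegrE ?mulr_ge0// ?(ltW r0)//.
apply: lt_le_trans D; rewrite ltrDl mulr_gt0// subr_gt0.
by rewrite ltrXn2r// nnegrE.
Qed.

(** The map [y -> (s / r) (y - z)], with [s = |x|], sends the points of B(x, r) with norm in [I] to
    points of B(0, s) with norm in [I]. A downward closed [I] covers open and closed balls about the
    origin at once. *)
Lemma ball_radial_contraction (I : set R) x r :
  (forall s t, 0 <= s -> s <= t -> I t -> I s) ->
  0 < r -> 0 < enorm x ->
  exists z, forall y, enorm (esub y x) <= r -> I (enorm y) ->
    I (enorm x / r * enorm (esub y z)) /\
    enorm x / r * enorm (esub y z) <= enorm x.
Proof.
set s := enorm x => Idown r0 s0.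
have sr0 : 0 < s / r by rewrite divr_gt0.
(* If [s] is in [I], every norm up to [s] is allowed and [z = x] works. *)
have [Is|nIs] := pselect (I s).
  exists x => y yx _.
  have le_s : s / r * enorm (esub y x) <= s.
    by rewrite -mulrA ger_pMr// mulrC ler_pdivrMr// mul1r.
  by split=> //; apply: (Idown _ s) => //; rewrite mulr_ge0 ?enorm_ge0// ltW.
have I_lt u : I u -> u < s.
  move=> Iu; rewrite ltNge; apply/negP => su; apply: nIs.
  by apply: Idown Iu => //; rewrite ltW.
(* If [s <= r], the map with [z = 0] only shortens vectors. *)
have [sr|rs] := leP s r.
  exists [tuple 0 | i < n] => y _ Iy.
  have -> : esub y [tuple 0 | i < n] = y.
    by apply: eq_from_tnth => i; rewrite !tnth_mktuple subr0.
  have le_y : s / r * enorm y <= enorm y.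
    by rewrite ler_piMl ?enorm_ge0// ler_pdivrMr// mul1r.
  split; last by rewrite (le_trans le_y)// ltW// I_lt.
  by apply: Idown Iy => //; rewrite mulr_ge0 ?enorm_ge0// ltW.
have [I0|nI0] := pselect (I 0); last first.
  exists x => y _ Iy; exfalso; apply: nI0; apply: Idown Iy => //.
  exact: enorm_ge0.
have supI : has_sup I.
  by split; [exists 0 | exists s => u /I_lt/ltW].
pose t := sup I.
have t0 : 0 <= t by apply: ub_le_sup => //; case: supI.
have ts : t <= s by apply: ge_sup => [|u /I_lt/ltW//]; exists 0.
have [z zP] := ball_intersection_center x r t r0 rs t0 ts.
exists z => y yx Iy; have [zle zlt] := zP _ yx.
have yt : enorm y <= t by apply: ub_le_sup => //; case: supI.
have sE (b : R) : s / r * b = s * b / r by ring.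
have wt : s / r * enorm (esub y z) <= t.
  by rewrite sE ler_pdivrMr// (mulrC t); exact: zle.
have w0 : 0 <= s / r * enorm (esub y z) by rewrite mulr_ge0 ?enorm_ge0// ltW.
split; last exact: le_trans ts.
(* When the supremum [t] is not attained, the strict form of the intersection estimate is
   required. *)
have [It|nIt] := pselect (I t); first exact: Idown It.
have {}yt : enorm y < t.
  by rewrite lt_neqAle yt andbT; apply: contra_notN nIt => /eqP <-.
have {}wt : s / r * enorm (esub y z) < t.
  by rewrite sE ltr_pdivrMr// (mulrC t); exact: zlt.
have [u Iu /ltW wu] := sup_gt (ex_intro _ 0 I0) wt.
exact: Idown Iu.
Qed.

End euclidean_geometry.

(** * Measurability and volume of balls *)

Section euclidean_balls.
Context {R : realType} {n : nat}.
Implicit Types (x y : Rn R n) (r : R).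
Let o : Rn R n := [tuple 0%R | i < n].

Lemma esub0 y : esub y o = y.
Proof. by apply: eq_from_tnth => i; rewrite !tnth_mktuple subr0. Qed.

Lemma measurable_enorm_sub x : measurable_fun setT (fun y => enorm (esub y x)).
Proof.
have msqrt : measurable_fun setT (@Num.sqrt R).
  by apply: continuous_measurable_fun; exact: sqrt_continuous.
apply: (measurableT_comp msqrt).
apply: measurable_sum => i; apply: measurable_funX.
under eq_fun do rewrite tnth_mktuple.
by apply: measurable_funB => //; exact: measurable_tnth.
Qed.

Lemma measurable_ecball x r : measurable (ecball x r).
Proof.
rewrite (_ : ecball x r = (fun y => enorm (esub y x)) @^-1` `]-oo, r]%classic).
  by rewrite -[X in measurable X]setTI; exact: measurable_enorm_sub.
by apply/seteqP; split => y; rewrite /ecball/= in_itv.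
Qed.

Lemma lebesgue_ecball x r : (0 < r)%R ->
  lebesgue_Rn R n (ecball x r) = (r ^+ n)%:E * lebesgue_Rn R n (ecball o 1).
Proof.
move=> r0; rewrite -(lebesgue_Rn_affine x)//; last exact: measurable_ecball.
congr (lebesgue_Rn R n _).
have E y : [tuple ((tnth y i - tnth x i) / r)%R | i < n] =
    escale r^-1 (esub y x).
  by apply: eq_from_tnth => i; rewrite !tnth_mktuple mulrC.
apply/seteqP; split=> y;
  rewrite /ecball/= esub0 E enorm_scale ?invr_ge0 ?(ltW r0)//;
  by rewrite ler_pdivrMl// mulr1.
Qed.

Let lebesgue_cube (a : R) : (0 < a)%R ->
  lebesgue_Rn R n [set y | forall i, tnth y i \in `[(- a)%R, a]] =
  ((a + a) ^+ n)%:E.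
Proof.
move=> a0.
rewrite (@lebesgue_Rn_box R n (fun=> [set` `[(- a)%R, a]]))//.
rewrite (eq_bigr (fun=> (a + a)%:E)) => [|i _].
  by rewrite prodEFin prodr_const card_ord.
by rewrite lebesgue_measure_itv/= lte_fin gtrN// -EFinB opprK.
Qed.

Lemma lebesgue_ecball_gt0 : 0 < lebesgue_Rn R n (ecball o 1).
Proof.
(* The cube of half-side [a] lies in the unit ball, since [n a^2 <= n a <= 1]; [n.+1] keeps [a]
   positive in dimension zero. *)
pose a := (n.+1%:R^-1)%R : R.
have a0 : (0 < a)%R by rewrite invr_gt0.
apply: (@lt_le_trans _ _ ((a + a) ^+ n)%:E).
  by rewrite lte_fin exprn_gt0// addr_gt0.
rewrite -lebesgue_cube//; apply: le_lebesgue_Rn => y ya.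
rewrite /ecball/= esub0 -(@expr_le1 _ 2) ?enorm_ge0// sqr_enorm.
apply: (@le_trans _ _ (\sum_(i < n) a)%R).
  apply: ler_sum => i _; have := ya i; rewrite in_itv/= -ler_norml => yi.
  rewrite -real_normK ?num_real// (@le_trans _ _ (a ^+ 2)%R)//.
    by rewrite lerXn2r// nnegrE// ltW.
  by rewrite expr2 ger_pMr// invf_le1// ler1n.
by rewrite sumr_const card_ord -mulr_natl ler_pdivrMr// mul1r ler_nat.
Qed.

Lemma lebesgue_ecball1_fin_num : lebesgue_Rn R n (ecball o 1) \is a fin_num.
Proof.
rewrite ge0_fin_numE ?measure_ge0//.
(* The volume of an enclosing cube of half-side 1. *)
apply: (@le_lt_trans _ _ ((1 + 1) ^+ n)%:E); last by rewrite ltry.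
rewrite -lebesgue_cube//; apply: le_lebesgue_Rn => y.
rewrite /ecball/= esub0 => y1 i; rewrite in_itv/= -ler_norml.
rewrite -(@expr_le1 _ 2)// real_normK ?num_real//.
apply: (@le_trans _ _ (enorm y ^+ 2)%R); last by rewrite expr_le1 ?enorm_ge0.
rewrite sqr_enorm (bigD1 i)//= lerDl sumr_ge0// => j _; exact: sqr_ge0.
Qed.

End euclidean_balls.

(** * Means of radial decreasing functions *)

Section radial_decreasing.
Context {R : realType} {n : nat}.
Let o : Rn R n := [tuple 0%R | i < n].

(** In dimension zero the measure is a unit point mass, hence the condition on [n]. *)
Lemma lebesgue_Rn_set1 : (0 < n)%N -> lebesgue_Rn R n [set o] = 0.
Proof.
case: n @o => // m o' _.
rewrite (_ : [set o'] =
    [set y | forall i, [set 0%R : measurableTypeR R] (tnth y i)]).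
  rewrite (@lebesgue_Rn_box R _ (fun=> [set 0%R])) => [|_]; last first.
    exact: measurable_set1.
  by rewrite big_ord_recl lebesgue_measure_set1 mul0e.
apply/seteqP; split => y /=; first by move=> -> i; rewrite tnth_mktuple.
by move=> y0; apply: eq_from_tnth => i; rewrite y0 tnth_mktuple.
Qed.

Lemma ecball0 : ecball o 0 = [set o].
Proof.
apply/seteqP; split=> y; rewrite /ecball/= esub0; last first.
  by move=> ->; rewrite enorm0.
by move=> y0; apply: enorm_eq0; apply: le_anti; rewrite y0 enorm_ge0.
Qed.

Lemma measurable_origin : measurable [set o].
Proof. by rewrite -ecball0; exact: measurable_ecball. Qed.

Lemma lebesgue_ecball_superlevel (g : Rn R n -> R) (x : Rn R n) (r u : R) :
  (0 < n)%N -> measurable_fun setT g -> radial_decreasing g ->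
  (0 < r)%R -> (0 < enorm x)%R -> (0 <= u)%R ->
  lebesgue_Rn R n (ecball x r `&` [set y | (u < `|g y|)%R]) <=
  ((r / enorm x) ^+ n)%:E *
    lebesgue_Rn R n (ecball o (enorm x) `&` [set y | (u < `|g y|)%R]).
Proof.
move=> n0 mg [f [f0 fdec gf]] r0 x0 u0.
set s := enorm x.
(* Admitting all [t <= 0] makes [I] downward closed whatever [f] does there, and puts the norm of
   the origin in [I]. *)
pose I := [set t : R | (t <= 0)%R \/ (u < f t)%R].
have Idown t t' : (0 <= t)%R -> (t <= t')%R -> I t' -> I t.
  move=> t0 tt' It'; have [t_le0|t_gt0] := leP t 0%R; first by left.
  by right; case: It' => [|/lt_le_trans]; [lra | apply; exact: fdec].
have gI y : y <> o -> (u < `|g y|)%R <-> I (enorm y).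
  move=> yo; rewrite gf//.
  have y0 : (0 < enorm y)%R.
    by rewrite lt_neqAle enorm_ge0 andbT; apply/eqP => /esym/enorm_eq0.
  by rewrite ger0_norm ?f0//; split=> [?|[|//]]; [right | rewrite leNgt y0].
set S := ecball o s `&` [set y | (u < `|g y|)%R].
have mS : measurable S.
  apply: measurableI; first exact: measurable_ecball.
  rewrite (_ : [set y | _] = (fun y => `|g y|)%R @^-1` `]u, +oo[%classic).
    rewrite -[X in measurable X]setTI.
    by apply: measurableT_comp => //; exact: measurable_itv.
  by apply/seteqP; split => y /=; rewrite in_itv/= andbT.
have mS0 : measurable (S `|` [set o]).
  by apply: measurableU => //; exact: measurable_origin.
(* The contraction may hit the origin, where [g] is arbitrary; adding this null point is free. *)
have -> : lebesgue_Rn R n S = lebesgue_Rn R n (S `|` [set o]).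
  apply/eqP; rewrite eq_le le_lebesgue_Rn//=.
  rewrite -[leRHS]adde0 -(lebesgue_Rn_set1 n0).
  exact: measureU2 mS measurable_origin.
have rs0 : (0 < r / s)%R by rewrite divr_gt0.
have [z zP] := ball_radial_contraction I x r Idown r0 x0.
rewrite -(lebesgue_Rn_affine z)//; apply: le_lebesgue_Rn => y [yxr uy] /=.
set w := mktuple _.
have wE : w = escale (s / r) (esub y z).
  by apply: eq_from_tnth => i; rewrite !tnth_mktuple invf_div mulrC.
have Iy : I (enorm y).
  have [->|/eqP yo] := eqVneq y o; first by left; rewrite enorm0.
  exact/gI.
have [Iw ws] := zP _ yxr Iy.
have sr0 : (0 <= s / r)%R by rewrite divr_ge0// ltW.
rewrite -enorm_scale// -wE in Iw; rewrite -enorm_scale// -wE in ws.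
have [->|/eqP wo] := eqVneq w o; first by right.
by left; split; [rewrite /ecball/= esub0 | exact/gI].
Qed.

(** As volumes scale like the [n]-th power of the radius, this compares the mean over B(x, r) with
    the mean over B(0, |x|). *)
Lemma integral_ecball_le (g : Rn R n -> R) (x : Rn R n) (r : R) :
  (0 < n)%N -> measurable_fun setT g -> radial_decreasing g ->
  (0 < r)%R -> (0 < enorm x)%R ->
  \int[lebesgue_Rn R n]_(y in ecball x r) `|(g y)%:E| <=
  ((r / enorm x) ^+ n)%:E *
    \int[lebesgue_Rn R n]_(y in ecball o (enorm x)) `|(g y)%:E|.
Proof.
move=> n0 mg rg r0 x0; have rx0 : (0 <= (r / enorm x) ^+ n)%R.
  by rewrite exprn_ge0// divr_ge0// ltW.
apply: (@le_integral_superlevel _ _ _ (lebesgue_Rn R n) _ _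
  (fun y => `|g y|)%R) => //.
- exact: measurable_ecball.
- exact: measurable_ecball.
- exact: measurableT_comp.
- by move=> u u0; exact: lebesgue_ecball_superlevel.
Qed.

End radial_decreasing.

(** * The weak-type bound *)

Theorem theorem2p7 (R : realType) (d : nat) (hd : (1 <= d)%N)
    (g : Rn R d -> R)
    (hg : (lebesgue_Rn R d).-integrable [set: Rn R d] (EFin \o g))
    (hrad : radial_decreasing g)
    (alpha : R) (halpha : (0 < alpha)%R) :
  lebesgue_Rn R d [set x | alpha%:E < centered_maximal g x] <=
  'N[lebesgue_Rn R d]_1[EFin \o g] / alpha%:E.
Proof.
have mg : measurable_fun setT g.
  by apply/measurable_EFinP; exact: measurable_int hg.
pose o : Rn R d := [tuple 0%R | i < d].
have := lebesgue_ecball_gt0 (R := R) (n := d).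
have := lebesgue_ecball1_fin_num (R := R) (n := d).
rewrite -/o; set W := lebesgue_Rn R d (ecball o 1) => Wfin W0.
have W_gt0 : (0 < fine W)%R by rewrite fine_gt0// W0 -ge0_fin_numE// ltW.
rewrite Lnorm1.
have /integrableP[_] := hg.
set N := \int[_]_x _ => Noo.
have N0 : 0 <= N by exact: integral_ge0.
have Nfin : N \is a fin_num by rewrite ge0_fin_numE.
have fN0 : (0 <= fine N)%R by exact: fine_ge0.
have d0 : (d != 0)%N by rewrite -lt0n.
(* [p] is the [d]-th power of the radius [rho] for which B(0, rho) has volume [N / alpha]. *)
pose p := (fine N / alpha / fine W)%R.
have p0 : (0 <= p)%R by rewrite !divr_ge0// ltW.
have [rho rho0 rhoE] : exists2 rho : R, (0 <= rho)%R & (rho ^+ d = p)%R.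
  exists (p `^ d%:R^-1)%R; first exact: powR_ge0.
  by rewrite -powR_mulrn ?powR_ge0// -powRrM mulVf ?pnatr_eq0// powRr1.
have NE : N / alpha%:E = p%:E * W.
  rewrite -(fineK Nfin) -(fineK Wfin) inver gt_eqF// -!EFinM; congr EFin.
  by rewrite /p /= divfK// gt_eqF.
have -> : N / alpha%:E = lebesgue_Rn R d (ecball o rho).
  (* The scaling formula needs a positive radius; for [rho = 0] the ball is the null set of the
     origin. *)
  rewrite NE -rhoE; have [->|rho_neq0] := eqVneq rho 0%R.
    by rewrite expr0n (negbTE d0) mul0e ecball0 lebesgue_Rn_set1.
  by rewrite (lebesgue_ecball o)// lt_neqAle eq_sym rho_neq0.
apply: le_lebesgue_Rn => x /= /ereal_sup_gt[_ [r /= r0 <-]].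
rewrite /ecball/= -/o esub0.
have [x_le0|x_gt0] := leP (enorm x) 0%R; first by rewrite (le_trans x_le0).
rewrite lebesgue_ecball// -/o -/W -(fineK Wfin) -EFinM inver gt_eqF; last first.
  by rewrite mulr_gt0// exprn_gt0.
rewrite lte_pdivlMr ?mulr_gt0 ?exprn_gt0// => ltI.
have := lt_le_trans ltI (integral_ecball_le _ _ _ hd mg hrad r0 x_gt0).
rewrite -/o; set J := \int[_]_(y in ecball o _) _ => ltJ.
have JN : J <= N.
  apply: ge0_subset_integral => //; first exact: measurable_ecball.
  by apply: measurableT_comp => //; apply/measurable_EFinP.
have {ltJ JN} : (alpha * (r ^+ d * fine W))%:E <
    ((r / enorm x) ^+ d * fine N)%:E.
  rewrite [ltLHS]EFinM [ltRHS]EFinM fineK//.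
  apply: (lt_le_trans ltJ); rewrite lee_wpmul2l// lee_fin exprn_ge0//.
  by rewrite divr_ge0// ltW.
rewrite lte_fin expr_div_n => ltN.
rewrite -(@ler_pXn2r _ d) ?nnegrE// ?(ltW x_gt0)// rhoE /p.
rewrite ler_pdivlMr// ler_pdivlMr// ltW//.
(* Multiplying by [(r / |x|)^d] brings the goal to the form of [ltN]. *)
rewrite -(@ltr_pM2l _ (r ^+ d / enorm x ^+ d)%R); last first.
  by rewrite divr_gt0// exprn_gt0.
apply: le_lt_trans ltN.
rewrite le_eqVlt; apply/orP; left; apply/eqP; field.
by rewrite expf_eq0 negb_and orbC gt_eqF.
Qed.
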